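(* Let $G=G_1\Box\, G_2$ be the Cartesian product of two finite partial cubes $G_1$ and $G_2$. Then $$\dim_I(G)=\dim_I(G_1)+\dim_I(G_2).$$
   Context: Graphs are simple, undirected and nonempty. For a set $X$, the hypercube $\mathcal H(X)$ is the graph whose vertices are the finite subsets of $X$, with $P,Q$ adjacent iff $|P\Delta Q|=1$; its dimension is the cardinality $|X|$. A graph is a partial cube if it can be isometrically embedded (i.e. by a map preserving shortest-path distances) into some $\mathcal H(X)$. The isometric dimension $\dim_I(G)$ of a partial cube $G$ is the minimum possible dimension of a hypercube $\mathcal H(X)$ into which $G$ is isometrically embeddable. The Cartesian product $G_1\Box\,G_2$ of $G_1=(V_1,E_1)$ and $G_2=(V_2,E_2)$ has vertex set $V_1\times V_2$, with $(u_1,u_2)$ adjacent to $(v_1,v_2)$ iff either $u_1v_1\in E_1$ and $u_2=v_2$, or $u_1=v_1$ and $u_2v_2\in E_2$. The Cartesian product of two partial cubes is a partial cube. *)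

(* Defs.v *)
From HB Require Import structures.
From mathcomp Require Import all_boot finmap.
From mathcomp Require Import boolp classical_sets functions cardinality.

Set Implicit Arguments.
Unset Strict Implicit.
Unset Printing Implicit Defensive.

Local Open Scope classical_set_scope.
Local Open Scope card_scope.

(* Vertex types are choiceTypes so that [{fset X}] is again a vertex type;
   classically this is no restriction. Graphs may be infinite. *)
Record sgraph := SGraph {
  vertex :> choiceType;
  adj : rel vertex;
  adj_sym : symmetric adj;
  adj_irr : irreflexive adj;
  vertex_inh : inhabited vertex
}.

Definition walk (G : sgraph) (u v : G) (n : nat) : Prop :=
  exists p : seq G, [/\ path (@adj G) u p, last u p = v & size p = n].

(* [None] stands for the infinite distance between vertices that lie in
   different components. *)
Definition dist (G : sgraph) (u v : G) : option nat :=
  match pselect (exists n, `[< walk u v n >]) with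
  | left ex => Some (ex_minn ex)
  | right _ => None
  end.

Definition isometric (G H : sgraph) (f : G -> H) : Prop :=
  forall u v : G, dist (f u) (f v) = dist u v.

Definition isometrically_embeddable (G H : sgraph) : Prop :=
  exists f : G -> H, isometric f.

Section Hypercube.
Variable X : choiceType.
Local Open Scope fset_scope.

Definition fsymdiff (P Q : {fset X}) : {fset X} := (P `\` Q) `|` (Q `\` P).

Definition hypercube_adj : rel {fset X} :=
  fun P Q => #|` fsymdiff P Q| == 1%N.

Lemma hypercube_adj_sym : symmetric hypercube_adj.
Proof. by move=> P Q; rewrite /hypercube_adj /fsymdiff fsetUC. Qed.

Lemma hypercube_adj_irr : irreflexive hypercube_adj.
Proof. by move=> P; rewrite /hypercube_adj /fsymdiff fsetDv fsetU0 cardfs0. Qed.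

Definition hypercube : sgraph :=
  SGraph hypercube_adj_sym hypercube_adj_irr (inhabits fset0).

End Hypercube.

Definition partial_cube (G : sgraph) : Prop :=
  exists X : choiceType, isometrically_embeddable G (hypercube X).

(* [n] is the least cardinality of a set [X], finite or infinite, such that [G]
   embeds isometrically into [hypercube X]. *)
Definition is_isometric_dim (G : sgraph) (n : nat) : Prop :=
  (exists X : choiceType,
     [set: X] #= `I_n /\ isometrically_embeddable G (hypercube X)) /\
  (forall X : choiceType,
     isometrically_embeddable G (hypercube X) -> `I_n #<= [set: X]).

(* Junk value 0 when no natural number is the isometric dimension, which does
   not happen for finite partial cubes. *)
Definition isometric_dim (G : sgraph) : nat :=
  xget 0%N [set n | is_isometric_dim G n].

Section CartesianProduct.
Variables G1 G2 : sgraph.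

Definition cartesian_adj : rel (G1 * G2)%type := fun u v =>
  (adj u.1 v.1 && (u.2 == v.2)) || ((u.1 == v.1) && adj u.2 v.2).

Lemma cartesian_adj_sym : symmetric cartesian_adj.
Proof.
move=> u v; rewrite /cartesian_adj.
by rewrite (adj_sym u.1) (adj_sym u.2) (eq_sym u.1) (eq_sym u.2).
Qed.

Lemma cartesian_adj_irr : irreflexive cartesian_adj.
Proof. by move=> u; rewrite /cartesian_adj !adj_irr andbF. Qed.

Lemma cartesian_inh : inhabited (G1 * G2)%type.
Proof. by case: (vertex_inh G1) (vertex_inh G2) => x [y]; exact: inhabits (x, y). Qed.

Definition cartesian_product : sgraph :=
  SGraph cartesian_adj_sym cartesian_adj_irr cartesian_inh.

End CartesianProduct.

Notation "G1 □ G2" := (cartesian_product G1 G2)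
  (at level 40, left associativity).

(* Main.v *)
(* Distances in a hypercube are cardinalities of symmetric differences, and
   distances in a Cartesian product add up.  Hence two embeddings combine into an
   embedding of the product over the disjoint union of the coordinate sets, which
   gives "<=".  Conversely, given an isometric embedding of the product, a
   coordinate separating two vertices of one layer separates the corresponding
   vertices of every parallel layer, and never two vertices of a transversal
   layer.  So the coordinates varying in the first factor and those varying in the
   second are disjoint, and each set alone suffices to embed its factor. *)
Require Import Defs.
From mathcomp Require Import all_boot finmap.
From mathcomp Require Import boolp classical_sets functions cardinality.

Set Implicit Arguments.
Unset Strict Implicit.
Unset Printing Implicit Defensive.

Local Open Scope classical_set_scope.

(** * Cardinal inequalities as injections between types *)

Section Cardinality.
Local Open Scope card_scope.

Lemma card_le_setTP (T U : Type) :
  [set: T] #<= [set: U] <-> exists f : T -> U, injective f.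
Proof.
split=> [/card_leP[g]|[f injf]].
  pose i (x : T) : [set: T] := exist _ x (mem_setT x).
  exists (fun x => val (g (i x))) => x y /val_inj e.
  have : i x = i y by apply: (@inj _ _ _ g) e; rewrite in_setT.
  by case.
have injT : {in [set: T] &, injective f} by move=> x y _ _; exact: injf.
by rewrite -(card_le_eql (inj_card_eq injT)); exact: card_leT.
Qed.

Lemma card_II_le_setTP (U : Type) n :
  `I_n #<= [set: U] <-> exists f : 'I_n -> U, injective f.
Proof. by rewrite (card_le_eql card_II) card_le_setTP. Qed.

Lemma infinite_card_II_le (U : Type) n : infinite_set [set: U] -> `I_n #<= [set: U].
Proof. by move/infiniteP; apply: card_le_trans; exact: card_leT. Qed.

(** Later [P1] and [P2] select the coordinates attached to the two factors; [X] may be infinite. *)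
Lemma card_II_le_disjoint (X : Type) (P1 P2 : pred X) n1 n2 :
  (forall x, P1 x -> ~~ P2 x) ->
  `I_n1 #<= [set: {x | P1 x}] -> `I_n2 #<= [set: {x | P2 x}] ->
  `I_(n1 + n2) #<= [set: X].
Proof.
move=> dis /card_II_le_setTP[f1 inj1] /card_II_le_setTP[f2 inj2].
apply/card_II_le_setTP.
exists (fun i : 'I_(n1 + n2) =>
  match fintype.split i with inl j => val (f1 j) | inr j => val (f2 j) end).
have f12 j k : val (f1 j) <> val (f2 k).
  by move=> e; have := dis _ (valP (f1 j)); rewrite e (valP (f2 k)).
move=> i j e; apply: (can_inj (@splitK n1 n2)); move: e.
case: (fintype.split i) (fintype.split j) => [a|a] [b|b] //.
- by move/val_inj/inj1 => ->.
- by move/f12.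
- by move/esym/f12.
- by move/val_inj/inj2 => ->.
Qed.

End Cardinality.

(** * Distances as lengths of shortest walks *)

Section Distance.
Variable G : sgraph.
Implicit Types u v : G.

Lemma dist_SomeP u v n :
  dist u v = Some n <-> walk u v n /\ (forall m, walk u v m -> (n <= m)%N).
Proof.
rewrite /dist; case: pselect => [ex|nex]; last first.
  by split=> // -[w _]; case: nex; exists n; apply/asboolP.
case: ex_minnP => k /asboolP wk mink; split=> [[<-]|[wn minn]].
  by split=> // m /asboolP/mink.
congr Some; apply/eqP; rewrite eqn_leq (minn _ wk) andbT.
by apply/mink/asboolP.
Qed.

Lemma walk0 u v : walk u v 0 <-> u = v.
Proof.
split=> [[p [_ + /size0nil p0]]|->]; first by rewrite p0.
by exists [::].
Qed.

Lemma walkS u v n : walk u v n.+1 <-> exists2 w, adj u w & walk w v n.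
Proof.
split=> [[[|w p] []]|[w uw [p [pp l s]]]] //.
  by move=> /= /andP[uw pp] l [s]; exists w => //; exists p.
by exists (w :: p); rewrite /= uw pp s.
Qed.

End Distance.

(** * Symmetric differences and hypercube distances *)

Section SymmetricDifference.
Variable X : choiceType.
Local Open Scope fset_scope.
Implicit Types P Q R : {fset X}.

Lemma in_fsymdiff P Q x : (x \in fsymdiff P Q) = (x \in P) (+) (x \in Q).
Proof. by rewrite /fsymdiff !inE; case: (x \in P); case: (x \in Q). Qed.

Lemma fsymdiffPP P : fsymdiff P P = fset0.
Proof. by apply/fsetP => x; rewrite in_fsymdiff addbb. Qed.

Lemma fsymdiff_eq0 P Q : fsymdiff P Q = fset0 -> P = Q.
Proof.
move=> e; apply/fsetP => x; have := in_fset0 x; rewrite -e in_fsymdiff.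
by case: (x \in P); case: (x \in Q).
Qed.

Lemma fsymdiff_subU P Q R : fsymdiff P R `<=` fsymdiff P Q `|` fsymdiff Q R.
Proof.
apply/fsubsetP => x; rewrite inE !in_fsymdiff.
by case: (x \in P); case: (x \in Q); case: (x \in R).
Qed.

Lemma card_fsymdiff_triangle P Q R :
  (#|` fsymdiff P R| <= #|` fsymdiff P Q| + #|` fsymdiff Q R|)%N.
Proof.
apply: leq_trans (fsubset_leq_card (fsymdiff_subU P Q R)) _.
by rewrite -cardfsUI leq_addr.
Qed.

(** Equality in the triangle inequality puts [Q] on a geodesic from [P] to [R], so no coordinate
    changes on both halves: by inclusion-exclusion, the two differences have an intersection of
    cardinality at most 0. *)
Lemma fsymdiff_between P Q R x :
  #|` fsymdiff P R| = (#|` fsymdiff P Q| + #|` fsymdiff Q R|)%N ->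
  x \in fsymdiff P Q -> x \notin fsymdiff Q R.
Proof.
move=> e xPQ; apply/negP => xQR.
have := fsubset_leq_card (fsymdiff_subU P Q R).
rewrite e -cardfsUI -[leqRHS]addn0 leq_add2l leqn0 cardfs_eq0 => /eqP I0.
by have := in_fset0 x; rewrite -I0 inE xPQ xQR.
Qed.

Lemma walk_hypercube_ge P Q n :
  walk (P : hypercube X) Q n -> (#|` fsymdiff P Q| <= n)%N.
Proof.
elim: n P => [|n IH] P; first by move/walk0 => ->; rewrite fsymdiffPP cardfs0.
case/walkS => R /eqP PR /IH RQ.
by apply: leq_trans (card_fsymdiff_triangle P R Q) _; rewrite PR.
Qed.

Lemma walk_hypercube P Q : walk (P : hypercube X) Q #|` fsymdiff P Q|.
Proof.
move e : #|` _| => n; elim: n P e => [|n IH] P.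
  by move/eqP; rewrite cardfs_eq0 => /eqP/fsymdiff_eq0 ->; apply/walk0.
move=> e; have [x xPQ] : exists x, x \in fsymdiff P Q.
  by apply/fset0Pn; rewrite -cardfs_eq0 e.
(* Flipping a coordinate [x] on which [P] and [Q] differ gives a neighbour of [P] whose difference
   to [Q] has lost exactly [x]. *)
apply/walkS; exists (fsymdiff P [fset x]).
  apply/eqP; rewrite -[RHS](cardfs1 x); congr (#|` _|).
  by apply/fsetP => y; rewrite !in_fsymdiff addbA addbb addFb.
apply: IH; suff -> : fsymdiff (fsymdiff P [fset x]) Q = fsymdiff P Q `\ x.
  by move: e; rewrite (cardfsD1 x) xPQ => -[].
apply/fsetP => y; rewrite in_fsetD1 !in_fsymdiff in_fset1.
have [->|_] := eqVneq y x; last by rewrite addbF.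
by move: xPQ; rewrite in_fsymdiff addbAC => ->.
Qed.

Lemma dist_hypercube P Q :
  dist (P : hypercube X) Q = Some #|` fsymdiff P Q|.
Proof.
apply/dist_SomeP; split; first exact: walk_hypercube.
by move=> m /walk_hypercube_ge.
Qed.

Lemma isometric_hypercubeP (G : sgraph) (f : G -> hypercube X) :
  isometric f <-> forall u v, dist u v = Some #|` fsymdiff (f u) (f v)|.
Proof. by split=> h u v; move: (h u v); rewrite dist_hypercube. Qed.

End SymmetricDifference.

(** * Changing the coordinate set of an embedding *)

Section Embeddings.
Local Open Scope fset_scope.

Lemma card_fset_image (X Y : choiceType) (h : X -> Y) (A : {fset X}) :
  injective h -> #|` [fset h x | x in A]| = #|` A|.
Proof. by move=> injh; rewrite card_imfset. Qed.

Lemma mem_fset_image (X Y : choiceType) (h : X -> Y) (A : {fset X}) x :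
  injective h -> (h x \in [fset h x | x in A]) = (x \in A).
Proof. by move=> injh; rewrite mem_imfset. Qed.

Lemma embeddable_inj (X Y : choiceType) (h : X -> Y) (G : sgraph) :
  injective h -> isometrically_embeddable G (hypercube X) ->
  isometrically_embeddable G (hypercube Y).
Proof.
move=> injh [f /isometric_hypercubeP fP].
exists (fun u => [fset h x | x in (f u : {fset X})]).
apply/isometric_hypercubeP => u v; rewrite fP; congr Some.
rewrite -(card_fset_image _ injh); congr (#|` _|).
apply/fsetP => y; rewrite in_fsymdiff.
have [[x <-]|nh] := pselect (exists x, h x = y).
  by rewrite !mem_fset_image // in_fsymdiff.
have F (A : {fset X}) : (y \in [fset h x | x in A]) = false.
  by apply/negP => /imfsetP[x _ e]; case: nh; exists x.
by rewrite !F.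
Qed.

(** A coordinate outside [P] never separates two images, so dropping it changes no symmetric
    difference. *)
Lemma embeddable_sub (X : choiceType) (P : pred X) (G : sgraph)
    (f : G -> {fset X}) :
  (forall u v, dist u v = Some #|` fsymdiff (f u) (f v)|) ->
  (forall u v x, x \in fsymdiff (f u) (f v) -> P x) ->
  isometrically_embeddable G (hypercube {x | P x}).
Proof.
move=> fP Psub.
(* The sets [f u] need not lie inside [P]; [pmap insub] discards their common part outside it. *)
pose F u : {fset {x | P x}} := [fset y in pmap insub (f u)].
have inF u y : (y \in F u) = (val y \in f u) by rewrite in_fset /= mem_pmap_sub.
exists F; apply/isometric_hypercubeP => u v; rewrite fP; congr Some.
rewrite -(card_fset_image _ val_inj); congr (#|` _|).
apply/fsetP => x; apply/idP/imfsetP => [xuv|[y /= + ->]]; last first.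
  by rewrite !in_fsymdiff !inF.
exists (Sub x (Psub _ _ _ xuv)) => //=.
by rewrite in_fsymdiff !inF -in_fsymdiff.
Qed.

Lemma finite_embeddable (G : sgraph) : finite_set [set: G] -> partial_cube G ->
  exists n, isometrically_embeddable G (hypercube 'I_n).
Proof.
move=> finG [X [f /isometric_hypercubeP fP]].
(* Finitely many finite sets use only finitely many coordinates, whatever the size of [X]. *)
pose S : {fset X} := fset_set (\bigcup_(u in [set: G]) [set` (f u : {fset X})]).
have inS u x : x \in (f u : {fset X}) -> x \in S.
  move=> xu; rewrite in_fset_set; first by apply/mem_set; exists u.
  by apply: bigcup_finite => // i _; exact: finite_fset.
have emb : isometrically_embeddable G (hypercube {x | x \in S}).
  apply: (embeddable_sub fP) => u v x.
  rewrite in_fsymdiff; case: (boolP (x \in (f u : {fset X}))) => [/inS //|_].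
  exact: inS.
exists #|` S|; rewrite cardfE.
pose h (y : {x | x \in S}) : 'I_#|{: S}| := enum_rank [` valP y].
apply: (embeddable_inj (h := h)) emb => y z /enum_rank_inj/(congr1 val) /=.
exact: val_inj.
Qed.

End Embeddings.

(** * Existence and uniqueness of the isometric dimension *)

Section IsometricDimension.
Local Open Scope card_scope.

Lemma card_eq_II_embeddable (X : choiceType) (G : sgraph) n :
  [set: X] #= `I_n -> isometrically_embeddable G (hypercube X) ->
  isometrically_embeddable G (hypercube 'I_n).
Proof.
move=> Xn; have : [set: X] #<= [set: 'I_n].
  by rewrite -(card_le_eqr card_II); case/card_eqPle: Xn.
by move=> /card_le_setTP[h injh]; exact: embeddable_inj injh.
Qed.

Lemma is_isometric_dim_inj (G : sgraph) m n :
  is_isometric_dim G m -> is_isometric_dim G n -> m = n.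
Proof.
suff le a b : is_isometric_dim G a -> is_isometric_dim G b -> (a <= b)%N.
  by move=> hm hn; apply/eqP; rewrite eqn_leq !le.
move=> [_ min] [[X [Xb emb]] _].
by rewrite -card_le_II -(card_le_eqr Xb) min.
Qed.

Lemma isometric_dim_unique (G : sgraph) n :
  is_isometric_dim G n -> isometric_dim G = n.
Proof.
move=> dn; apply: (is_isometric_dim_inj _ dn).
(* The witness [n] shows that the set is nonempty, so [xget] does not fall back to 0. *)
by apply: (xgetPex 0%N); exists n.
Qed.

(** It suffices to minimise over the sets ['I_n]: a finite [X] can be replaced by an ordinal type of
    the same size, and an infinite one exceeds every [n]. *)
Lemma isometric_dimP (G : sgraph) : finite_set [set: G] -> partial_cube G ->
  is_isometric_dim G (isometric_dim G).
Proof.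
move=> finG pcG; apply: (xgetPex 0%N).
have [k ek] := finite_embeddable finG pcG.
have ex : exists n, `[< isometrically_embeddable G (hypercube 'I_n) >].
  by exists k; apply/asboolP.
case: (ex_minnP ex) => n /asboolP en minn.
exists n; split; first by exists 'I_n; split=> //; rewrite card_eq_sym card_II.
move=> X embX; have [/finite_setP[m Xm]|infX] := pselect (finite_set [set: X]).
  rewrite (card_le_eqr Xm) card_le_II; apply/minn/asboolP.
  exact: card_eq_II_embeddable embX.
exact: infinite_card_II_le.
Qed.

End IsometricDimension.

(** * Distances and embeddings in Cartesian products *)

Section Product.
Variables G1 G2 : sgraph.

(** Each edge of the product moves in exactly one factor, so a walk splits into its two projections.
    Conversely, the walk in the first factor is performed first, then the one in the second. *)
Lemma walk_cartesianP (u v : G1 □ G2) n :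
  walk u v n <-> exists n1 n2,
    [/\ n = (n1 + n2)%N, walk u.1 v.1 n1 & walk u.2 v.2 n2].
Proof.
split.
  elim: n u => [|n IH] u.
    by move/walk0 => ->; exists 0%N, 0%N; split=> //; apply/walk0.
  case/walkS => w uw /IH[n1 [n2 [-> w1 w2]]].
  case/orP: uw => /andP[].
    move=> uw /eqP e; exists n1.+1, n2; split=> //; last by rewrite e.
    by apply/walkS; exists w.1.
  move=> /eqP e uw; exists n1, n2.+1; split; rewrite ?addnS ?e //.
  by apply/walkS; exists w.2.
case=> n1 [n2 [-> +]]; clear n; case: u v => u1 u2 [v1 v2] /=.
elim: n1 u1 => [|n1 IH] u1.
  move/walk0 => ->; rewrite add0n.
  elim: n2 u2 => [|n2 IH] u2; first by move/walk0 => ->; apply/walk0.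
  case/walkS => w uw /IH ww; apply/walkS; exists (v1, w) => //.
  by rewrite /= /cartesian_adj /= eqxx uw orbT.
case/walkS => w uw /IH ww /ww {}ww; apply/walkS; exists (w, u2) => //.
by rewrite /= /cartesian_adj /= eqxx uw.
Qed.

Lemma dist_cartesian (u v : G1 □ G2) d1 d2 :
  dist u.1 v.1 = Some d1 -> dist u.2 v.2 = Some d2 ->
  dist u v = Some (d1 + d2)%N.
Proof.
move=> /dist_SomeP[w1 m1] /dist_SomeP[w2 m2]; apply/dist_SomeP; split.
  by apply/walk_cartesianP; exists d1, d2.
by move=> m /walk_cartesianP[n1 [n2 [-> /m1 l1 /m2 l2]]]; rewrite leq_add.
Qed.

Local Open Scope fset_scope.

Lemma embeddable_cartesian (X1 X2 : choiceType) :
  isometrically_embeddable G1 (hypercube X1) ->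
  isometrically_embeddable G2 (hypercube X2) ->
  isometrically_embeddable (G1 □ G2) (hypercube (X1 + X2)%type).
Proof.
move=> [f1 /isometric_hypercubeP f1P] [f2 /isometric_hypercubeP f2P].
have injl : injective (@inl X1 X2) by move=> x y [].
have injr : injective (@inr X1 X2) by move=> x y [].
pose U (A : {fset X1}) (B : {fset X2}) : {fset X1 + X2} :=
  [fset inl x | x in A] `|` [fset inr x | x in B].
have inUl A B x : (inl x \in U A B) = (x \in A).
  rewrite /U in_fsetU mem_fset_image //.
  by case: imfsetP => [[]|] //; rewrite orbF.
have inUr A B x : (inr x \in U A B) = (x \in B).
  rewrite /U in_fsetU mem_fset_image //.
  by case: imfsetP => [[]|].
have cardU A B : #|` U A B| = (#|` A| + #|` B|)%N.
  (* The added 0 is read as the cardinality of the empty intersection of the two images, to fit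
     inclusion-exclusion. *)
  rewrite -[LHS]addn0 -(cardfs0 (X1 + X2)%type).
  have <- : [fset inl x | x in A] `&` [fset inr x | x in B] = fset0.
    apply/fsetP => y; rewrite in_fsetI in_fset0.
    by apply/negP => /andP[/imfsetP[a _ ->] /imfsetP[b _]].
  by rewrite cardfsUI !card_fset_image.
exists (fun u => U (f1 u.1) (f2 u.2)).
apply/isometric_hypercubeP => u v.
rewrite (dist_cartesian (f1P _ _) (f2P _ _)) -cardU; congr (Some #|` _|).
by apply/fsetP => -[x|x]; rewrite in_fsymdiff ?inUl ?inUr in_fsymdiff.
Qed.

(** * Coordinates changing along the layers of the product *)

Section Layers.
Variables (X : choiceType) (f : G1 * G2 -> {fset X}).
Variables (d1 : G1 -> G1 -> nat) (d2 : G2 -> G2 -> nat).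
Hypothesis fd : forall u v,
  #|` fsymdiff (f u) (f v)| = (d1 u.1 v.1 + d2 u.2 v.2)%N.
Hypotheses (d1xx : forall a, d1 a a = 0%N) (d2xx : forall c, d2 c c = 0%N).

(** By [fd], both sides of the equality in [fsymdiff_between] are [d1 a b + d2 c d], the diagonal
    terms being 0. *)
Lemma layers_disjoint1 a b c d x :
  x \in fsymdiff (f (a, c)) (f (b, c)) ->
  x \notin fsymdiff (f (b, c)) (f (b, d)).
Proof. by apply: fsymdiff_between; rewrite !fd /= d1xx d2xx addn0. Qed.

Lemma layers_disjoint2 a b c d x :
  x \in fsymdiff (f (a, c)) (f (a, d)) ->
  x \notin fsymdiff (f (a, d)) (f (b, d)).
Proof. by apply: fsymdiff_between; rewrite !fd /= d1xx d2xx addn0 addnC. Qed.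

(* Three consecutive corners of (a,c), (b,c), (b,d), (a,d) lie on a geodesic, so
   along this 4-cycle no coordinate changes twice in a row: a coordinate that
   changes on one side changes on the opposite side. *)
Lemma layers_parallel1 a b c d x :
  x \in fsymdiff (f (a, c)) (f (b, c)) -> x \in fsymdiff (f (a, d)) (f (b, d)).
Proof.
have := @layers_disjoint1 a b c d x; have := @layers_disjoint2 a b d c x.
rewrite !in_fsymdiff.
by case: (x \in f (a, c)); case: (x \in f (b, c)); case: (x \in f (a, d));
   case: (x \in f (b, d)) => //= /(_ isT).
Qed.

Lemma layers_parallel2 a b c d x :
  x \in fsymdiff (f (a, c)) (f (a, d)) -> x \in fsymdiff (f (b, c)) (f (b, d)).
Proof.
have := @layers_disjoint2 a b c d x; have := @layers_disjoint2 a b d c x.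
rewrite !in_fsymdiff.
by case: (x \in f (a, c)); case: (x \in f (b, c)); case: (x \in f (a, d));
   case: (x \in f (b, d)) => //= /(_ isT).
Qed.

Definition colour1 : pred X :=
  fun x => `[< exists a b c, x \in fsymdiff (f (a, c)) (f (b, c)) >].
Definition colour2 : pred X :=
  fun x => `[< exists a c d, x \in fsymdiff (f (a, c)) (f (a, d)) >].

Lemma colours_disjoint x : colour1 x -> ~~ colour2 x.
Proof.
move=> /asboolP[a [b [c h]]]; apply/asboolPn => -[a' [c' [d' h']]].
(* Both changes are carried to sides meeting at the corner [(b, c')], where [x] would change twice
   in a row. *)
have := layers_disjoint1 d' (layers_parallel1 c' h).
by rewrite (layers_parallel2 b h').
Qed.

End Layers.

Local Open Scope card_scope.

(** Hypercube distances are finite, so an isometric embedding into a hypercube excludes [None]. *)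
Lemma dist_fun (G : sgraph) : partial_cube G ->
  exists2 d : G -> G -> nat, (forall u, d u u = 0%N)
                           & forall u v, dist u v = Some (d u v).
Proof.
case=> X [g /isometric_hypercubeP gP].
exists (fun u v => #|` fsymdiff (g u) (g v)|) => // u.
by rewrite fsymdiffPP cardfs0.
Qed.

Lemma cartesian_card_ge n1 n2 (X : choiceType) :
  partial_cube G1 -> partial_cube G2 ->
  is_isometric_dim G1 n1 -> is_isometric_dim G2 n2 ->
  isometrically_embeddable (G1 □ G2) (hypercube X) ->
  `I_(n1 + n2) #<= [set: X].
Proof.
move=> /dist_fun[d1 d1xx d1P] /dist_fun[d2 d2xx d2P] [_ min1] [_ min2].
case=> f /isometric_hypercubeP fP.
have fd u v : #|` fsymdiff (f u) (f v)| = (d1 u.1 v.1 + d2 u.2 v.2)%N.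
  by have := fP u v; rewrite (dist_cartesian (d1P _ _) (d2P _ _)) => -[].
(* Nonempty factors supply [x1] and [x2], which fix one layer in each direction. Along it the
   summand of the other factor is 0, so [f] restricts to an isometric embedding that uses only the
   colours of one factor. *)
have [x1] := vertex_inh G1; have [x2] := vertex_inh G2.
apply: (card_II_le_disjoint (colours_disjoint fd d1xx d2xx)).
  apply/min1/(embeddable_sub (f := fun a => f (a, x2))) => [a b|a b x h].
    by rewrite fd d2xx addn0.
  by apply/asboolP; exists a, b, x2.
apply/min2/(embeddable_sub (f := fun c => f (x1, c))) => [c d|c d x h].
  by rewrite fd d1xx.
by apply/asboolP; exists x1, c, d.
Qed.

Lemma is_isometric_dim_cartesian n1 n2 :
  partial_cube G1 -> partial_cube G2 ->
  is_isometric_dim G1 n1 -> is_isometric_dim G2 n2 ->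
  is_isometric_dim (G1 □ G2) (n1 + n2).
Proof.
move=> pc1 pc2 dim1 dim2; split; last first.
  by move=> X; exact: cartesian_card_ge.
exists 'I_(n1 + n2); split; first by rewrite card_eq_sym card_II.
have [[X1 [X1n e1]] _] := dim1; have [[X2 [X2n e2]] _] := dim2.
(* [unsplit] relabels the disjoint union of ['I_n1] and ['I_n2] by ['I_(n1 + n2)]. *)
apply: (embeddable_inj (can_inj (@unsplitK n1 n2))).
by apply: embeddable_cartesian; apply: card_eq_II_embeddable; eassumption.
Qed.

End Product.

Theorem theorem6p1 (G1 G2 : sgraph)
  (finG1 : finite_set [set: G1]) (finG2 : finite_set [set: G2])
  (pcG1 : partial_cube G1) (pcG2 : partial_cube G2) :
  isometric_dim (G1 □ G2) = (isometric_dim G1 + isometric_dim G2)%N.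
Proof.
apply: isometric_dim_unique.
by apply: is_isometric_dim_cartesian => //; exact: isometric_dimP.
Qed.
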